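(* Let $\Lambda=\{\alpha_1,\ldots,\alpha_n\}$, $\Omega=\{\beta_1,\ldots,\beta_m\}$ and $k$ satisfy the node assumptions (N) described in the context. For $i=1,\ldots,k$ let $$\widetilde\alpha_i=P_{\Lambda_i,\ell}^{\mathbf{e}_\ell}(\alpha_i)^{-1}\,\alpha_i\,P_{\Lambda_i,\ell}^{\mathbf{e}_\ell}(\alpha_i),\qquad \widetilde\beta_i=P_{\Omega_i,r}^{\mathbf{e}_r}(\beta_i)\,\beta_i\,P_{\Omega_i,r}^{\mathbf{e}_r}(\beta_i)^{-1},$$ so that $\widetilde\alpha_i\sim\alpha_i\sim\beta_i\sim\widetilde\beta_i$, and let $\Pi_{\widetilde\alpha_i,\widetilde\beta_i}$ be the plane defined in the context. Then a polynomial $f\in\mathbb{H}[z]$ belongs to $\mathbb{I}_{\Lambda,\ell}\cap\mathbb{I}_{\Omega,r}$, i.e. satisfies $$f^{\mathbf{e}_\ell}(\alpha_i)=0\ (1\le i\le n),\qquad f^{\mathbf{e}_r}(\beta_j)=0\ (1\le j\le m),$$ if and only if it is of the form $$f(z)=\sum_{i=1}^kP_{\Lambda,\ell}(z)\,\mu_i\,P_{\Omega_i,r}(z)+P_{\Lambda,\ell}(z)\,h(z)\,P_{\Omega,r}(z)$$ for some $h\in\mathbb{H}[z]$ and $\mu_i\in\Pi_{\widetilde\alpha_i,\widetilde\beta_i}$ ($1\le i\le k$).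
   Context: $\mathbb{H}$ is the skew field of real quaternions, $\overline{\alpha}$ the quaternionic conjugate. $\mathbb{H}[z]$ is the ring of polynomials in a formal variable $z$ commuting with the quaternionic coefficients. For $f(z)=\sum_k z^kf_k$ and $\alpha\in\mathbb{H}$, $f^{\mathbf{e}_\ell}(\alpha)=\sum_k\alpha^kf_k$ and $f^{\mathbf{e}_r}(\alpha)=\sum_kf_k\alpha^k$. $\alpha\sim\beta$ (equivalent) means $\alpha=h^{-1}\beta h$ for some nonzero $h\in\mathbb{H}$; $[\alpha]$ is the conjugacy class of $\alpha$. $\mathbb{I}_{\Lambda,\ell}$ is the set (right ideal) of all $f\in\mathbb{H}[z]$ with $f^{\mathbf{e}_\ell}(\alpha)=0$ for all $\alpha\in\Lambda$; $\mathbb{I}_{\Omega,r}$ is the set (left ideal) of all $f$ with $f^{\mathbf{e}_r}(\beta)=0$ for all $\beta\in\Omega$. Minimal polynomials: for a finite set $S\subset\mathbb{H}$, $P_{S,\ell}$ (resp. $P_{S,r}$) is the unique monic polynomial of lowest degree whose left (resp. right) evaluation vanishes at every element of $S$; $P_{\emptyset,\ell}=P_{\emptyset,r}=1$. Put $\Lambda_i=\Lambda\setminus\{\alpha_i\}$, $\Omega_i=\Omega\setminus\{\beta_i\}$. Node assumptions (N): $\alpha_1,\ldots,\alpha_n$ are distinct quaternions, $\beta_1,\ldots,\beta_m$ are distinct quaternions ($\Lambda$ and $\Omega$ need not be disjoint), $\Omega\cap\mathbb{R}=\emptyset$; no three interpolation nodes are equivalent, i.e. $|V\cap\Lambda|+|V\cap\Omega|\le2$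 for every conjugacy class $V$; and $k\ge0$ is such that $\alpha_i\sim\beta_i$ for $1\le i\le k$, $[\alpha_i]\cap\Omega=\emptyset$ for $k<i\le n$, and $[\beta_j]\cap\Lambda=\emptyset$ for $k<j\le m$. Planes: for equivalent non-real $\alpha=x+yI$, $\beta=x+y\widetilde I$ with $x\in\mathbb{R}$, $y>0$ and $I,\widetilde I$ purely imaginary unit quaternions, $\Pi_{\alpha,\beta}$ is the real two-dimensional subspace of $\mathbb{H}\cong\mathbb{R}^4$ given by $\mathrm{span}_{\mathbb R}\{1,I\}$ if $\beta=\alpha$; $(\mathrm{span}_{\mathbb R}\{1,I\})^\perp$ if $\beta=\overline\alpha$; $\mathrm{span}_{\mathbb R}\{I+\widetilde I,\,1-I\widetilde I\}$ if $\beta\ne\alpha,\overline\alpha$. *)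

(* Defs.v *)
From HB Require Import structures.
From mathcomp Require Import all_boot all_order all_algebra.
From mathcomp Require Import ring.
From mathcomp Require Import boolp classical_sets functions cardinality reals.

Set Implicit Arguments.
Unset Strict Implicit.
Unset Printing Implicit Defensive.

Import Order.TTheory GRing.Theory Num.Theory.

Local Open Scope classical_set_scope.
Local Open Scope ring_scope.

Record quat (R : Type) := Quat { q0 : R; q1 : R; q2 : R; q3 : R }.

Definition quat_to_tuple (R : Type) (a : quat R) := (q0 a, q1 a, q2 a, q3 a).
Definition quat_of_tuple (R : Type) (t : R * R * R * R) :=
  let: (a, b, c, d) := t in Quat a b c d.
Lemma quat_to_tupleK (R : Type) : cancel (@quat_to_tuple R) (@quat_of_tuple R).
Proof. by case. Qed.

HB.instance Definition _ (R : eqType) :=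
  Equality.copy (quat R) (can_type (@quat_to_tupleK R)).
HB.instance Definition _ (R : choiceType) :=
  Choice.copy (quat R) (can_type (@quat_to_tupleK R)).

Section QuaternionAlgebra.
Variable R : realType.
Local Notation H := (quat R).
Implicit Types a b : H.

Definition addq a b := Quat (q0 a + q0 b) (q1 a + q1 b) (q2 a + q2 b) (q3 a + q3 b).
Definition oppq a := Quat (- q0 a) (- q1 a) (- q2 a) (- q3 a).
Definition mulq a b := Quat
  (q0 a * q0 b - q1 a * q1 b - q2 a * q2 b - q3 a * q3 b)
  (q0 a * q1 b + q1 a * q0 b + q2 a * q3 b - q3 a * q2 b)
  (q0 a * q2 b - q1 a * q3 b + q2 a * q0 b + q3 a * q1 b)
  (q0 a * q3 b + q1 a * q2 b - q2 a * q1 b + q3 a * q0 b).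
Definition scaleq (x : R) a := Quat (x * q0 a) (x * q1 a) (x * q2 a) (x * q3 a).

Local Ltac quat_ring := move=> *; rewrite /addq /oppq /mulq /scaleq /=;
  congr Quat; ring.

Fact addqA : associative addq. Proof. by quat_ring. Qed.
Fact addqC : commutative addq. Proof. by quat_ring. Qed.
Fact add0q : left_id (Quat 0 0 0 0) addq.
Proof. by case=> *; rewrite /addq /= !add0r. Qed.
Fact addNq : left_inverse (Quat 0 0 0 0) oppq addq. Proof. by quat_ring. Qed.
HB.instance Definition _ := GRing.isZmodule.Build H addqA addqC add0q addNq.

Fact mulqA : associative mulq. Proof. by quat_ring. Qed.
Fact mul1q : left_id (Quat 1 0 0 0) mulq.
Proof. by case=> *; quat_ring. Qed.
Fact mulq1 : right_id (Quat 1 0 0 0) mulq.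
Proof. by case=> *; quat_ring. Qed.
Fact mulqDl : left_distributive mulq addq. Proof. by quat_ring. Qed.
Fact mulqDr : right_distributive mulq addq. Proof. by quat_ring. Qed.
Fact oneq_neq0 : Quat 1 0 0 0 != 0 :> H.
Proof. by apply/eqP => -[] /eqP; rewrite oner_eq0. Qed.
HB.instance Definition _ :=
  GRing.Zmodule_isNzRing.Build H mulqA mul1q mulq1 mulqDl mulqDr oneq_neq0.

Fact scaleqA x y a : scaleq x (scaleq y a) = scaleq (x * y) a.
Proof. by quat_ring. Qed.
Fact scale1q : left_id 1 scaleq. Proof. by case=> *; rewrite /scaleq /= !mul1r. Qed.
Fact scaleqDr : right_distributive scaleq addq. Proof. by quat_ring. Qed.
Fact scaleqDl a x y : scaleq (x + y) a = addq (scaleq x a) (scaleq y a). Proof. by quat_ring. Qed.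
HB.instance Definition _ :=
  GRing.Zmodule_isLmodule.Build R H scaleqA scale1q scaleqDr scaleqDl.

Fact scaleqAl (x : R) a b : scaleq x (mulq a b) = mulq (scaleq x a) b. Proof. by quat_ring. Qed.
HB.instance Definition _ := GRing.Lmodule_isLalgebra.Build R H scaleqAl.
Fact scaleqAr (x : R) a b : scaleq x (mulq a b) = mulq a (scaleq x b). Proof. by quat_ring. Qed.
HB.instance Definition _ := GRing.Lalgebra_isAlgebra.Build R H scaleqAr.

Definition qconj a := Quat (q0 a) (- q1 a) (- q2 a) (- q3 a).
Definition qdot a b := q0 a * q0 b + q1 a * q1 b + q2 a * q2 b + q3 a * q3 b.
Definition qnorm a := Num.sqrt (qdot a a).
Definition invq a := (qdot a a)^-1 *: qconj a.

Lemma qdot_eq0 a : (qdot a a == 0) = (a == 0).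
Proof.
apply/eqP/eqP => [|->]; last by rewrite /qdot /= !mulr0 !addr0.
case: a => a b c d /eqP; rewrite /qdot /=.
rewrite !paddr_eq0 ?addr_ge0 -?expr2 ?sqr_ge0 // !sqrf_eq0.
by move=> /andP[/andP[/andP[/eqP-> /eqP->] /eqP->] /eqP->].
Qed.

Fact mulVq : {in [pred a | a != 0], left_inverse 1 invq *%R}.
Proof.
move=> a; rewrite inE -qdot_eq0 /qdot => a0.
by congr Quat; rewrite /= /qdot; field.
Qed.
Fact mulqV : {in [pred a | a != 0], right_inverse 1 invq *%R}.
Proof.
move=> a; rewrite inE -qdot_eq0 /qdot => a0.
by congr Quat; rewrite /= /qdot; field.
Qed.
Fact unitqP a b : b * a = 1 /\ a * b = 1 -> a \in [pred a | a != 0].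
Proof.
by case=> ba _; rewrite inE; apply: contra_eq_neq ba => ->;
  rewrite mulr0 eq_sym oner_neq0.
Qed.
Fact invq_out : {in [predC [pred a | a != 0]], invq =1 id}.
Proof. by move=> a; rewrite !inE negbK => /eqP->; congr Quat; rewrite /= ?oppr0 mulr0. Qed.
HB.instance Definition _ :=
  GRing.NzRing_hasMulInverse.Build H mulVq mulqV unitqP invq_out.

Lemma unitqE a : (a \is a GRing.unit) = (a != 0). Proof. by []. Qed.

Definition qsim a b := exists2 h : H, h != 0 & a = h^-1 * b * h.

Definition qclass a : set H := [set b | qsim b a].

(* For [a = x + y I] with [x] real, [y > 0] and [I] a purely imaginary unit,
   [qim a = y I], [qnorm (qim a) = y] and [qunit a = I]. *)
Definition qim a : H := Quat 0 (q1 a) (q2 a) (q3 a).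
Definition qunit a : H := (qnorm (qim a))^-1 *: qim a.

Definition qspan2 (u v : H) : set H := [set p | exists x y : R, p = x *: u + y *: v].
Definition qperp (S : set H) : set H := [set p | forall q, S q -> qdot p q = 0].

Definition qplane a b : set H :=
  if b == a then qspan2 1 (qunit a)
  else if b == qconj a then qperp (qspan2 1 (qunit a))
  else qspan2 (qunit a + qunit b) (1 - qunit a * qunit b).

End QuaternionAlgebra.

Section QuaternionPolynomials.
Variable R : realType.
Local Notation H := (quat R).
Implicit Types (f g P Q : {poly H}) (S : set H) (a b : H).

(* Over a noncommutative ring the library's [f.[a]] puts the powers of [a] on
   the right of the coefficients, see [horner_coef]. *)
Definition leval f a : H := \sum_(i < size f) a ^+ i * f`_i.
Definition reval f a : H := f.[a].

Definition lideal S : set {poly H} := [set f | forall a, S a -> leval f a = 0].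
Definition rideal S : set {poly H} := [set f | forall a, S a -> reval f a = 0].

Definition lowest_monic (I : set {poly H}) : set {poly H} :=
  [set P | [/\ P \is monic, I P &
             forall Q, Q \is monic -> I Q -> (size P <= size Q)%N]].

(* [xget] picks an arbitrary element of the set; for finite [S] there is exactly
   one, see [lminpolyP], [rminpolyP], [lminpoly_unique] and [rminpoly_unique]. *)
Definition lminpoly S : {poly H} := xget 0 (lowest_monic (lideal S)).
Definition rminpoly S : {poly H} := xget 0 (lowest_monic (rideal S)).

Lemma leval_wide f a n : (size f <= n)%N ->
  leval f a = \sum_(i < n) a ^+ i * f`_i.
Proof.
move=> fn; rewrite /leval (big_ord_widen n (fun i => a ^+ i * f`_i)) //.
rewrite big_mkcond /=; apply: eq_bigr => i _.
by case: ltnP => // fi; rewrite nth_default // mulr0.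
Qed.

Lemma levalB f g a : leval (f - g) a = leval f a - leval g a.
Proof.
pose n := maxn (size f) (size g).
rewrite (@leval_wide (f - g) a n); last first.
  by rewrite (leq_trans (size_polyD _ _)) // size_polyN.
rewrite (@leval_wide f a n) ?leq_maxl // (@leval_wide g a n) ?leq_maxr //.
by rewrite -sumrB; apply: eq_bigr => i _; rewrite coefB mulrBr.
Qed.

Lemma levalMC f c a : leval (f * c%:P) a = leval f a * c.
Proof.
rewrite (@leval_wide (f * c%:P) a (size f)); last first.
  apply/leq_sizeP => j fj.
  by rewrite coefMC nth_default // mul0r.
by rewrite /leval mulr_suml; apply: eq_bigr => i _; rewrite coefMC mulrA.
Qed.

Lemma levalMX f a : leval (f * 'X) a = a * leval f a.
Proof.
rewrite (@leval_wide (f * 'X) a (size f).+1); last first.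
  by apply/leq_sizeP => -[|j] // fj; rewrite coefMX nth_default.
rewrite big_ord_recl coefMX eqxx mulr0 add0r /leval mulr_sumr.
by apply: eq_bigr => i _; rewrite coefMX /= mulrA exprS.
Qed.

Lemma lowest_monic_ex (I : set {poly H}) :
  (exists2 P, P \is monic & I P) -> exists P, lowest_monic I P.
Proof.
move=> [P Pm IP].
pose p n := `[< exists Q, [/\ Q \is monic, I Q & size Q = n] >].
have ep : exists n, p n by exists (size P); apply/asboolP; exists P.
case: (ex_minnP ep) => n /asboolP[Q [Qm IQ <-]] minQ.
exists Q; split=> // Q' Q'm IQ'; apply: minQ.
by apply/asboolP; exists Q'.
Qed.

Lemma lowest_monic_unique (I : set {poly H}) P Q :
  (forall f g, I f -> I g -> I (f - g)) ->
  (forall f, I f -> f != 0 -> exists2 g, g \is monic & I g /\ size g = size f) ->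
  lowest_monic I P -> lowest_monic I Q -> P = Q.
Proof.
move=> IB IM [Pm IP minP] [Qm IQ minQ].
apply/eqP; rewrite -subr_eq0; apply/negP => /negP PQ0.
have [g gm [Ig sg]] := IM _ (IB _ _ IP IQ) PQ0.
have sPQ : size P = size Q by apply/eqP; rewrite eqn_leq minP ?minQ.
have := minP _ gm Ig; rewrite sg leqNgt => /negP; apply.
have sP : (0 < size P)%N by rewrite size_poly_gt0 monic_neq0.
rewrite -[ltnRHS](prednK sP) ltnS; apply/leq_sizeP => j.
rewrite leq_eqVlt coefB => /orP[/eqP <-|].
  by rewrite -lead_coefE sPQ -lead_coefE (monicP Pm) (monicP Qm) subrr.
by rewrite (prednK sP) => Pj; rewrite !nth_default ?subrr // -sPQ.
Qed.

Lemma lideal_monic_ex S : finite_set S -> exists2 P, P \is monic & lideal S P.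
Proof.
move=> /finite_seqP[s ->]; elim: s => [|a s [P Pm IP]].
  by exists 1; rewrite ?monic1.
have [Pa0|Pa0] := eqVneq (leval P a) 0.
  by exists P => // b /=; rewrite inE => /orP[/eqP->|/IP].
exists (P * ('X - ((leval P a)^-1 * a * leval P a)%:P)).
  by rewrite monicMl // monicXsubC.
move=> b /=; rewrite inE mulrBr levalB levalMX levalMC => /orP[/eqP->|/IP ->].
  by rewrite !mulrA mulrV ?unitqE // mul1r subrr.
by rewrite mulr0 mul0r subrr.
Qed.

Lemma rideal_monic_ex S : finite_set S -> exists2 P, P \is monic & rideal S P.
Proof.
move=> /finite_seqP[s ->]; elim: s => [|a s [P Pm IP]].
  by exists 1; rewrite ?monic1.
have [Pa0|Pa0] := eqVneq (reval P a) 0.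
  by exists P => // b /=; rewrite inE => /orP[/eqP->|/IP].
exists (('X - (reval P a * a * (reval P a)^-1)%:P) * P).
  by rewrite monicMl // monicXsubC.
move=> b /=; rewrite inE /reval mulrBl -commr_polyX hornerD hornerN hornerMX hornerCM.
case/orP=> [/eqP->|/IP /= Pb]; first by rewrite -!mulrA mulVr ?unitqE // mulr1 subrr.
by rewrite /reval in Pb; rewrite Pb mulr0 mul0r subrr.
Qed.

Lemma lminpolyP S : finite_set S -> lowest_monic (lideal S) (lminpoly S).
Proof. by move=> /lideal_monic_ex/lowest_monic_ex; apply: xgetPex. Qed.

Lemma rminpolyP S : finite_set S -> lowest_monic (rideal S) (rminpoly S).
Proof. by move=> /rideal_monic_ex/lowest_monic_ex; apply: xgetPex. Qed.

Lemma lminpoly_unique S P :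
  finite_set S -> lowest_monic (lideal S) P -> P = lminpoly S.
Proof.
move=> Sf minP; apply: lowest_monic_unique minP (lminpolyP Sf).
  by move=> f g If Ig a Sa; rewrite levalB If // Ig // subrr.
move=> f If f0; have l0 : lead_coef f != 0 by rewrite lead_coef_eq0.
have l1 : lead_coef f * lead_coef (lead_coef f)^-1%:P = 1.
  by rewrite lead_coefC mulrV.
have n1 : lead_coef f * lead_coef (lead_coef f)^-1%:P != 0.
  by rewrite l1 oner_neq0.
exists (f * (lead_coef f)^-1%:P).
  by rewrite monicE lead_coef_proper_mul // l1.
split=> [a Sa|]; first by rewrite levalMC If // mul0r.
rewrite size_proper_mul // size_polyC.
by rewrite -unitqE unitrV unitqE l0 addn1.
Qed.

Lemma rminpoly_unique S P :
  finite_set S -> lowest_monic (rideal S) P -> P = rminpoly S.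
Proof.
move=> Sf minP; apply: lowest_monic_unique minP (rminpolyP Sf).
  by move=> f g If Ig a Sa; rewrite /reval hornerD hornerN -/(reval f a) -/(reval g a) If // Ig // subrr.
move=> f If f0; have l0 : lead_coef f != 0 by rewrite lead_coef_eq0.
have l1 : lead_coef (lead_coef f)^-1%:P * lead_coef f = 1.
  by rewrite lead_coefC mulVr.
have n1 : lead_coef (lead_coef f)^-1%:P * lead_coef f != 0.
  by rewrite l1 oner_neq0.
exists ((lead_coef f)^-1%:P * f).
  by rewrite monicE lead_coef_proper_mul // l1.
split=> [a Sa|]; first by rewrite /reval hornerCM -/(reval f a) If // mulr0.
rewrite size_proper_mul // size_polyC.
by rewrite -unitqE unitrV unitqE l0 add1n.
Qed.

Lemma lminpoly0 : lminpoly set0 = 1.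
Proof.
apply/esym/lminpoly_unique => //; split=> // [|Q Qm _]; first exact: monic1.
by rewrite size_poly1 size_poly_gt0 monic_neq0.
Qed.

Lemma rminpoly0 : rminpoly set0 = 1.
Proof.
apply/esym/rminpoly_unique => //; split=> // [|Q Qm _]; first exact: monic1.
by rewrite size_poly1 size_poly_gt0 monic_neq0.
Qed.

Definition ltwist S a : H :=
  let p := leval (lminpoly (S `\ a)) a in p^-1 * a * p.
Definition rtwist S b : H :=
  let p := reval (rminpoly (S `\ b)) b in p * b * p^-1.

End QuaternionPolynomials.

(* Main.v *)
Require Import Defs.
From HB Require Import structures.
From mathcomp Require Import all_boot all_order all_algebra.
From mathcomp Require Import ring.
From mathcomp Require Import boolp classical_sets functions cardinality reals.

Set Implicit Arguments.
Unset Strict Implicit.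
Unset Printing Implicit Defensive.

Import Order.TTheory GRing.Theory Num.Theory.

Local Open Scope classical_set_scope.
Local Open Scope ring_scope.

(** Every [f] vanishing on the left at [Lambda] is [P * g] with
    [P = lminpoly Lambda], so the theorem describes the [g] for which [P * g]
    also vanishes on the right at [Omega].  The evaluation rule for products
    (lemma [revalM]) says that [P * g] has right value
    [reval P (q * b * q^-1) * q] at [b], with [q = reval g b] nonzero.  Hence at
    every node either [g] vanishes or [q * b * q^-1] is a right root of [P].

    The right roots of [P] are under control because [P] is a product of linear
    factors taken from conjugates of nodes of [Lambda] (lemmas
    [lideal_generated] and [lminpoly_rroot]).  If the class of [b] misses
    [Lambda], then [P] has no root in it and [g] must vanish at [b].  If the
    class meets [Lambda] in the single node [a], then
    [P = lminpoly (Lambda `\ a) * ('X - a')], where [a'] is the twisted node,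
    and [a'] is the only right root of [P] in the class (lemma
    [lminpoly_rroot_twist]).  Whether or not [g] vanishes at such a [b],
    its value [q] there satisfies [a' * q = q * b].

    Let [p] be the right value of [rminpoly (Omega `\ b)] at [b] and [b'] the
    twisted node, so that [b' * p = p * b].  The quotient [mu = q / p] then
    satisfies [a' * mu = mu * b'].  Subtracting from [g] the terms
    [mu * rminpoly (Omega `\ b)] leaves a polynomial vanishing on the right at
    the whole of [Omega], hence a left multiple of [rminpoly Omega].
    Conversely, [('X - a') * mu = mu * ('X - b')] when [a' * mu = mu * b'], and
    [('X - b') * rminpoly (Omega `\ b)] vanishes on [Omega].

    It remains to see that the plane attached to equivalent non-real [a] and
    [b] is the set of solutions [c] of [a * c = c * b] (lemma [qplaneE]).  With
    [a = x + y u] and [b = x + y v] this reads [u * c = c * v] for imaginary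
    units [u] and [v].  When [v != - u], the particular nonzero solution [u + v]
    reduces the problem to the commutant of [v]. *)

(** * Conjugacy of quaternions and the planes of intertwiners *)

Section Conjugacy.
Variable R : realType.
Local Notation H := (quat R).
Implicit Types a b c h u v : H.

Lemma mulq_neq0 a b : a != 0 -> b != 0 -> a * b != 0.
Proof.
move=> a0 b0; apply/eqP => ab; move/eqP: b0; apply.
by rewrite -[b](mulKr (x := a)) ?unitqE // ab mulr0.
Qed.

Lemma qsim_intertwine h a b : h != 0 -> h * a = b * h -> qsim a b.
Proof. by move=> h0 e; exists h => //; rewrite -mulrA -e mulKr ?unitqE. Qed.

Lemma qsim_refl a : qsim a a.
Proof. by apply: (@qsim_intertwine 1); rewrite ?oner_neq0 // mul1r mulr1. Qed.

Lemma qsim_sym a b : qsim a b -> qsim b a.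
Proof.
case=> h h0 ->; apply: (@qsim_intertwine h^-1).
  by rewrite -unitqE unitrV unitqE.
by rewrite mulrK ?unitqE.
Qed.

Lemma qsim_trans b a c : qsim a b -> qsim b c -> qsim a c.
Proof.
move=> [h h0 ->] [g g0 ->].
apply: (@qsim_intertwine (g * h)); first exact: mulq_neq0.
by rewrite !mulrA mulrK ?unitqE // mulrV ?unitqE // mul1r.
Qed.

Lemma qdotMM a b : qdot (a * b) (a * b) = qdot a a * qdot b b.
Proof. by rewrite /qdot /=; ring. Qed.

Lemma qsim_q0 a b : qsim a b -> q0 a = q0 b.
Proof.
case=> h h0 ->; rewrite -mulrA.
have q0C c d : q0 (c * d) = q0 (d * c) by rewrite /=; ring.
by rewrite q0C mulrK ?unitqE.
Qed.

Lemma qsim_qnorm_qim a b : qsim a b -> qnorm (qim a) = qnorm (qim b).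
Proof.
move=> ab; have e0 := qsim_q0 ab; case: ab => h h0 e.
rewrite /qnorm; congr Num.sqrt.
have : qdot a a = qdot b b.
  apply: (mulfI (x := qdot h h)); first by rewrite qdot_eq0.
  by rewrite -qdotMM e mulrA mulrA mulrV ?unitqE // mul1r qdotMM mulrC.
rewrite /qdot /= e0 !mulr0 !add0r => E.
by apply: (addrI (q0 b * q0 b)); rewrite !addrA.
Qed.

Lemma quat_eq a b :
  q0 a = q0 b -> q1 a = q1 b -> q2 a = q2 b -> q3 a = q3 b -> a = b.
Proof. by case: a b => ? ? ? ? [? ? ? ?] /= -> -> -> ->. Qed.

Lemma qimE a : a = (q0 a)%:A + qim a.
Proof. by apply: quat_eq; rewrite /= ?mulr0 ?mulr1 ?addr0 ?add0r. Qed.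

Definition imunit u := q0 u = 0 /\ qdot u u = 1.

Lemma sqr_imunit u : imunit u -> u * u = -1.
Proof.
case: u => a b c d [/= -> N]; move: N; rewrite /qdot /= => N.
apply: quat_eq => /=; rewrite ?oppr0; first (rewrite -N); ring.
Qed.

(** The commutator of [u] and [c] is twice the cross product of their imaginary
    parts, so [c] commutes with [u] exactly when its imaginary part is
    parallel to [u]. *)
Lemma imunit_commute u c : imunit u -> u * c = c * u <-> qspan2 1 u c.
Proof.
move=> [u0 uu]; split=> [e|[x [y ->]]]; last first.
  by rewrite mulrDr mulrDl -!scalerAr -!scalerAl mul1r mulr1.
exists (q0 c), (qdot c u).
case: u c u0 uu e => u0 u1 u2 u3 [c0 c1 c2 c3] /= -> N.
move: N; rewrite /qdot /= mul0r add0r => N E.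
have e1 := congr1 (@q1 R) E; have e2 := congr1 (@q2 R) E.
have e3 := congr1 (@q3 R) E.
rewrite /= in e1 e2 e3.
(* A coordinate of the cross product is zero once it equals its opposite. *)
have half (x y : R) : y - x = x - y -> x = y.
  move=> /eqP; rewrite -subr_eq0 => /eqP z; apply/eqP; rewrite -subr_eq0.
  have : (x - y) *+ 2 == 0 by apply/eqP; rewrite -[RHS]oppr0 -z; ring.
  by rewrite mulrn_eq0.
(* Each intermediate sum below is a coordinate of [u * c], less the two terms
   that it shares with that of [c * u]. *)
have e12 : c1 * u2 = c2 * u1.
  by apply: half; transitivity
    (0 * c3 + u1 * c2 - u2 * c1 + u3 * c0 - c0 * u3 - c3 * 0);
   [ring|rewrite e3; ring].
have e23 : c2 * u3 = c3 * u2.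
  by apply: half; transitivity
    (0 * c1 + u1 * c0 + u2 * c3 - u3 * c2 - c0 * u1 - c1 * 0);
   [ring|rewrite e1; ring].
have e31 : c3 * u1 = c1 * u3.
  by apply: half; transitivity
    (0 * c2 - u1 * c3 + u2 * c0 + u3 * c1 - c0 * u2 - c2 * 0);
   [ring|rewrite e2; ring].
apply: quat_eq => /=; first by ring.
- rewrite -[LHS]mulr1 -N.
  transitivity (c1 * u1 * u1 + (c1 * u2) * u2 + (c1 * u3) * u3).
    by ring.
  by rewrite e12 -e31; ring.
- rewrite -[LHS]mulr1 -N.
  transitivity ((c2 * u1) * u1 + c2 * u2 * u2 + (c2 * u3) * u3).
    by ring.
  by rewrite -e12 e23; ring.
- rewrite -[LHS]mulr1 -N.
  transitivity ((c3 * u1) * u1 + (c3 * u2) * u2 + c3 * u3 * u3).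
    by ring.
  by rewrite e31 -e23; ring.
Qed.

(** The anticommutator [u * c + c * u] equals [2 q0(c) u - 2 <c, u>], and [1]
    and [u] are linearly independent. *)
Lemma imunit_anticommute u c : imunit u ->
  u * c = c * - u <-> qperp (qspan2 1 u) c.
Proof.
move=> [u0 uu].
have E : u * c + c * u = (q0 c *+ 2) *: u - (qdot c u *+ 2)%:A.
  move: u0; case: u {uu} => v0 u1 u2 u3; case: c => c0 c1 c2 c3 /= ->.
  by apply: quat_eq; rewrite /qdot /=; ring.
have dotS (x y : R) : qdot c (x *: 1 + y *: u) = x * q0 c + y * qdot c u.
  by rewrite /qdot /=; ring.
have -> : (u * c = c * - u) <-> (u * c + c * u = 0).
  by rewrite mulrN; split=> [->|/eqP]; [rewrite addNr|rewrite addr_eq0 => /eqP].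
rewrite E; split=> [e q [x [y ->]]|cP].
  have e0 := congr1 (@q0 R) e; rewrite /= u0 mulr0 add0r mulr1 in e0.
  have cu : qdot c u = 0.
    by move/eqP: e0; rewrite oppr_eq0 mulrn_eq0 => /eqP.
  rewrite dotS cu; move: e; rewrite cu mul0rn scale0r subr0 => /eqP.
  have un0 : u != 0 by rewrite -qdot_eq0 uu oner_eq0.
  rewrite scaler_eq0 (negPf un0) orbF mulrn_eq0 /= => /eqP ->.
  by rewrite !mulr0 addr0.
have c0 : q0 c = 0.
  have := cP _ (ex_intro _ 1 (ex_intro _ 0 erefl)).
  by rewrite dotS mul1r mul0r addr0.
have cu : qdot c u = 0.
  have := cP _ (ex_intro _ 0 (ex_intro _ 1 erefl)).
  by rewrite dotS mul1r mul0r add0r.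
by rewrite c0 cu !mul0rn !scale0r subrr.
Qed.

(** The sum [u + v] is itself an intertwiner, nonzero since [v != - u].  So
    [(u + v)^-1 * c] commutes with [v], hence is [x + y v], and
    [(u + v) * v = u * v - 1]. *)
Lemma imunit_intertwine u v c : imunit u -> imunit v -> v != - u ->
  u * c = c * v <-> qspan2 (u + v) (1 - u * v) c.
Proof.
move=> uI vI uv.
have uu := sqr_imunit uI; have vv := sqr_imunit vI.
have s0 : u + v != 0 by rewrite addrC addr_eq0.
have us : u * (u + v) = (u + v) * v by rewrite mulrDr mulrDl uu vv addrC.
have sv : (u + v) * v = - (1 - u * v) by rewrite mulrDl vv opprB.
split=> [e|[x [y ->]]]; last first.
  have ur : u * (1 - u * v) = (1 - u * v) * v.
    rewrite mulrBr mulrBl mul1r mulr1 mulrA uu -mulrA vv.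
    by rewrite mulN1r mulrN1 !opprK addrC.
  by rewrite mulrDr mulrDl -!scalerAr -!scalerAl us ur.
have [w cE] : exists w, c = (u + v) * w.
  by exists ((u + v)^-1 * c); rewrite mulVKr ?unitqE.
have /(imunit_commute _ vI)[x [y wE]] : v * w = w * v.
  apply: (mulrI (x := u + v)); first by rewrite unitqE.
  by rewrite mulrA -us -mulrA -cE e cE mulrA.
exists x, (- y); rewrite cE wE mulrDr -!scalerAr mulr1 sv.
by rewrite scalerN scaleNr.
Qed.

(** Equivalent quaternions have equal real parts and imaginary parts of equal
    norm, so both sides of [a * c = c * b] reduce to the imaginary units; the
    three cases of the plane are then the three lemmas above. *)
Lemma qplaneE a b c : qsim a b -> (forall x : R, b <> x%:A) ->
  qplane a b c <-> a * c = c * b.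
Proof.
move=> ab bnr; have e0 := qsim_q0 ab; have en := qsim_qnorm_qim ab.
have y0 : qnorm (qim b) != 0.
  rewrite /qnorm sqrtr_eq0 -ltNge lt_def qdot_eq0 /qdot.
  rewrite !addr_ge0 -?expr2 ?sqr_ge0 // andbT.
  by apply/eqP => b0; apply: (bnr (q0 b)); rewrite {1}[b]qimE b0 addr0.
have unitE d : qnorm (qim d) != 0 -> qim d = qnorm (qim d) *: qunit d.
  by move=> d0; rewrite scalerA mulfV // scale1r.
have unitI d : qnorm (qim d) != 0 -> imunit (qunit d).
  move=> d0; split=> /=; first by rewrite mulr0.
  have -> : qdot (qunit d) (qunit d)
      = (qnorm (qim d)) ^- 2 * qdot (qim d) (qim d).
    by rewrite /qunit /qdot /=; field.
  have dd : qnorm (qim d) ^+ 2 = qdot (qim d) (qim d).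
    by rewrite sqr_sqrtr // /qdot !addr_ge0 // -expr2 sqr_ge0.
  by rewrite -dd mulVf // expf_neq0.
have ya : qnorm (qim a) != 0 by rewrite en.
have -> : (a * c = c * b) <-> (qunit a * c = c * qunit b).
  rewrite /qunit en -scalerAl -scalerAr.
  rewrite {1}[a]qimE {1}[b]qimE mulrDl mulrDr e0 -scalerAl -scalerAr mul1r mulr1.
  split=> [/addrI -> //|e]; congr (_ + _).
  by rewrite -[LHS]scale1r -[RHS]scale1r -(mulfV y0) -!scalerA e.
rewrite /qplane; case: eqP => [->|ba].
  by rewrite -imunit_commute //; apply: unitI.
case: eqP => [bc|bc].
  have -> : qunit b = - qunit a.
    rewrite /qunit en bc -scalerN; congr (_ *: _).
    by apply: quat_eq; rewrite /= ?oppr0.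
  by rewrite imunit_anticommute //; apply: unitI.
rewrite imunit_intertwine //; [exact: unitI|exact: unitI|].
apply/eqP => uv; apply: bc; rewrite [b]qimE unitE // uv -en scalerN -unitE // -e0.
by apply: quat_eq; rewrite /= ?mulr0 ?mulr1 ?oppr0 ?addr0 ?add0r.
Qed.

End Conjugacy.

(** * Evaluation of products *)

Section Evaluation.
Variable R : realType.
Local Notation H := (quat R).
Implicit Types (f g P Q : {poly H}) (S : set H) (a b c : H).

Lemma levalD f g a : leval (f + g) a = leval f a + leval g a.
Proof.
have -> : f + g = f - (0 - g) by rewrite sub0r opprK.
have l0 : leval 0 a = 0 by rewrite /leval size_poly0 big_ord0.
by rewrite !levalB l0 sub0r opprK.
Qed.

Lemma levalC c a : leval c%:P a = c.
Proof.
rewrite (leval_wide a (size_polyC_leq1 c)).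
by rewrite big_ord1 expr0 mul1r coefC.
Qed.

Lemma levalXsubC c a : leval ('X - c%:P) a = a - c.
Proof. by rewrite levalB levalC -['X]mul1r levalMX levalC mulr1. Qed.

(** The evaluation maps are not multiplicative.  A coefficient of [f] meets
    [reval g b * b ^+ i]; the intertwining hypothesis moves the powers of [b]
    across the value of [g].  When that value is a unit, [b'] is its conjugate
    of [b]; when it is zero, [b'] is arbitrary. *)
Lemma revalM f g b b' :
  b' * reval g b = reval g b * b -> reval (f * g) b = reval f b' * reval g b.
Proof.
rewrite /reval => e; elim/poly_ind: f => [|f c IH].
  by rewrite mul0r !horner0 mul0r.
rewrite mulrDl -mulrA -commr_polyX mulrA hornerD hornerMX hornerCM IH.
by rewrite hornerD hornerMX hornerC mulrDl -!mulrA e.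
Qed.

(** Mirror image of the previous lemma: the value of the left factor now moves
    the evaluation point of the right one. *)
Lemma levalM f g a a' :
  leval f a * a' = a * leval f a -> leval (f * g) a = leval f a * leval g a'.
Proof.
move=> e; elim/poly_ind: g => [|g c IH]; first by rewrite mulr0 !levalC mulr0.
rewrite mulrDr mulrA !levalD levalMX levalMC IH levalMX levalC.
by rewrite mulrDr !mulrA e.
Qed.

Lemma levalM_eq0 f g a : leval f a = 0 -> leval (f * g) a = 0.
Proof. by move=> f0; rewrite (@levalM _ _ _ 0) f0 ?mul0r // mulr0. Qed.

Lemma revalM_eq0 f g b : reval g b = 0 -> reval (f * g) b = 0.
Proof. by move=> g0; rewrite (@revalM _ _ _ 0) g0 ?mulr0 // mul0r. Qed.

(** Evaluation is multiplicative up to conjugation by the value of the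
    adjacent factor, so a root of a product that is not a root of that factor
    moves to a conjugate root of the other one. *)
Lemma revalM_root f g b : reval (f * g) b = 0 -> reval g b != 0 ->
  exists d, [/\ qsim d b, d * reval g b = reval g b * b & reval f d = 0].
Proof.
set q := reval g b => fg0 q0.
have [d dq] : exists d, d * q = q * b.
  by exists (q * b * q^-1); rewrite mulrVK ?unitqE.
exists d; split=> //.
  by apply/qsim_sym; apply: (@qsim_intertwine _ q).
by rewrite -[LHS](mulrK (x := q)) ?unitqE // /q -revalM // fg0 mul0r.
Qed.

Lemma levalM_root f g a a' : leval (f * g) a = 0 -> leval f a != 0 ->
  leval f a * a' = a * leval f a -> leval g a' = 0.
Proof.
move=> fg0 f0 e; rewrite -[LHS](mulKr (x := leval f a)) ?unitqE //.
by rewrite -levalM // fg0 mulr0.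
Qed.

Lemma lfactor_theorem f a : leval f a = 0 -> exists g, f = ('X - a%:P) * g.
Proof.
suff [g E] : exists g, f = ('X - a%:P) * g + (leval f a)%:P.
  by move=> f0; exists g; rewrite [LHS]E f0 addr0.
elim/poly_ind: f => [|f c [g E]]; first by exists 0; rewrite levalC mulr0 addr0.
exists (g * 'X + (leval f a)%:P).
rewrite levalD levalMX levalC {1}E polyCD polyCM mulrDl mulrDr mulrA -!addrA.
congr (_ + _); rewrite mulrBl.
by rewrite commr_polyX addrA subrK.
Qed.

Lemma rfactor_theorem f b : reval f b = 0 -> exists g, f = g * ('X - b%:P).
Proof. by move=> f0; apply/factor_theorem/rootP. Qed.

(** * Ideals of polynomials vanishing on a finite set *)

Definition linprod (t : seq H) : {poly H} := \prod_(c <- t) ('X - c%:P).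

Lemma linprod_monic t : linprod t \is monic.
Proof. by apply: monic_prod => c _; apply: monicXsubC. Qed.

Lemma linprod_lroot t a :
  leval (linprod t) a = 0 -> exists2 c, c \in t & qsim a c.
Proof.
elim: t a => [|c t IH] a.
  by rewrite /linprod big_nil levalC => /eqP; rewrite oner_eq0.
have [->|ac] := eqVneq a c.
  by exists c; rewrite ?mem_head //; apply: qsim_refl.
have ac0 : leval ('X - c%:P) a != 0 by rewrite levalXsubC subr_eq0.
set p := leval _ a in ac0; pose a' := p^-1 * a * p.
have pa' : p * a' = a * p by rewrite /a' -mulrA mulVKr ?unitqE.
rewrite /linprod big_cons => /levalM_root/(_ ac0 pa')/IH[d dt a'd].
exists d; first by rewrite inE dt orbT.
by apply: qsim_trans a'd; apply: qsim_sym; exists p.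
Qed.

Lemma linprod_rroot t b :
  reval (linprod t) b = 0 -> exists2 c, c \in t & qsim b c.
Proof.
elim: t b => [|c t IH] b.
  by rewrite /linprod big_nil /reval hornerC => /eqP; rewrite oner_eq0.
have [/IH[d dt bd] _|q0] := eqVneq (reval (linprod t) b) 0.
  by exists d; rewrite // inE dt orbT.
rewrite /linprod big_cons => /revalM_root/(_ q0)[d [db _]].
rewrite /reval hornerXsubC => /eqP; rewrite subr_eq0 => /eqP dc.
by exists c; rewrite ?mem_head // -dc; apply: qsim_sym.
Qed.

(** By induction on an enumeration [s]: if [P] generates the ideal of [s] and
    [p] is the value of [P] at a new node [a], then [P] already works when
    [p = 0], and otherwise the multiples [P * g] vanishing at [a] are those with
    [g] vanishing at [p^-1 * a * p], so that one more linear factor is enough.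
    All the factors thus come from conjugates of nodes, which is what controls
    the other roots of the generator, on either side. *)
Lemma lideal_generated S : finite_set S ->
  exists t, [/\ forall c, c \in t -> exists2 a, S a & qsim c a,
    lideal S (linprod t) & forall f, lideal S f -> exists g, f = linprod t * g].
Proof.
move=> /finite_seqP[s ->]; elim: s => [|a s [t [tS It gen]]].
  by exists [::]; split=> // f _; exists f; rewrite /linprod big_nil mul1r.
have sub f : lideal [set` a :: s] f -> lideal [set` s] f.
  by move=> If b bs; apply: If; rewrite /= inE bs orbT.
have tS' c : c \in t -> exists2 b, [set` a :: s] b & qsim c b.
  by case/tS=> b bs cb; exists b; rewrite //= inE bs orbT.
set p := leval (linprod t) a.
have [p0|p0] := eqVneq p 0.
  exists t; split=> // [b|f /sub/gen //].
  by rewrite /= inE => /orP[/eqP->|/It].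
have up : p \is a GRing.unit by rewrite unitqE.
pose a' := p^-1 * a * p.
have pa' : p * a' = a * p by rewrite /a' -mulrA mulVKr.
have tE : linprod (rcons t a') = linprod t * ('X - a'%:P).
  by rewrite /linprod -cats1 big_cat big_seq1.
exists (rcons t a'); rewrite tE; split.
- move=> c; rewrite mem_rcons inE => /orP[/eqP->|/tS' //].
  by exists a; [rewrite /= mem_head|exists p].
- move=> b; rewrite /= inE => /orP[/eqP->|/It bt]; last exact: levalM_eq0.
  by rewrite (levalM _ pa') levalXsubC subrr mulr0.
move=> f If; have [g fE] := gen _ (sub _ If).
have : leval f a = 0 by apply: If; rewrite /= mem_head.
rewrite fE => /levalM_root/(_ p0 pa')/lfactor_theorem[h ->].
by exists h; rewrite mulrA.
Qed.

Lemma rideal_generated S : finite_set S ->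
  exists t, [/\ forall c, c \in t -> exists2 b, S b & qsim c b,
    rideal S (linprod t) & forall f, rideal S f -> exists g, f = g * linprod t].
Proof.
move=> /finite_seqP[s ->]; elim: s => [|b s [t [tS It gen]]].
  by exists [::]; split=> // f _; exists f; rewrite /linprod big_nil mulr1.
have sub f : rideal [set` b :: s] f -> rideal [set` s] f.
  by move=> If c cs; apply: If; rewrite /= inE cs orbT.
have tS' c : c \in t -> exists2 d, [set` b :: s] d & qsim c d.
  by case/tS=> d ds cd; exists d; rewrite //= inE ds orbT.
set p := reval (linprod t) b.
have [p0|p0] := eqVneq p 0.
  exists t; split=> // [c|f /sub/gen //].
  by rewrite /= inE => /orP[/eqP->|/It].
have up : p \is a GRing.unit by rewrite unitqE.
pose b' := p * b * p^-1.
have b'p : b' * p = p * b by rewrite /b' mulrVK.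
have tE : linprod (b' :: t) = ('X - b'%:P) * linprod t.
  by rewrite /linprod big_cons.
exists (b' :: t); rewrite tE; split.
- move=> c; rewrite inE => /orP[/eqP->|/tS' //].
  exists b; first by rewrite /= mem_head.
  by apply: qsim_sym; apply: (@qsim_intertwine _ p).
- move=> c; rewrite /= inE => /orP[/eqP->|/It bt]; last exact: revalM_eq0.
  by rewrite (revalM _ b'p) /reval hornerXsubC subrr mul0r.
move=> f If; have [g fE] := gen _ (sub _ If).
have : reval f b = 0 by apply: If; rewrite /= mem_head.
rewrite fE (revalM _ b'p) -/p => e.
have /rfactor_theorem[h ->] : reval g b' = 0.
  by rewrite -[LHS](mulrK up) e mul0r.
by exists h; rewrite mulrA.
Qed.

(** * Minimal polynomials *)

Lemma monic_lgen_lminpoly S P : finite_set S -> P \is monic -> lideal S P ->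
  (forall f, lideal S f -> exists g, f = P * g) -> P = lminpoly S.
Proof.
move=> Sf Pm IP gen; apply: lminpoly_unique => //; split=> // Q Qm /gen[g QE].
have g0 : g != 0.
  by apply: contraTneq (monic_neq0 Qm) => g0; rewrite QE g0 mulr0 eqxx.
rewrite QE size_monicM // -subn1 -addnBA ?leq_addr // size_poly_gt0 //.
Qed.

Lemma monic_rgen_rminpoly S P : finite_set S -> P \is monic -> rideal S P ->
  (forall f, rideal S f -> exists g, f = g * P) -> P = rminpoly S.
Proof.
move=> Sf Pm IP gen; apply: rminpoly_unique => //; split=> // Q Qm /gen[g QE].
have g0 : g != 0.
  by apply: contraTneq (monic_neq0 Qm) => g0; rewrite QE g0 mul0r eqxx.
by rewrite QE size_Mmonic // addnC -subn1 -addnBA ?leq_addr // size_poly_gt0.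
Qed.

Lemma lminpoly_linprod S : finite_set S -> exists2 t,
  (forall c, c \in t -> exists2 a, S a & qsim c a) & lminpoly S = linprod t.
Proof.
move=> Sf; have [t [tS It gen]] := lideal_generated Sf; exists t => //.
by apply/esym/monic_lgen_lminpoly => //; apply: linprod_monic.
Qed.

Lemma rminpoly_linprod S : finite_set S -> exists2 t,
  (forall c, c \in t -> exists2 b, S b & qsim c b) & rminpoly S = linprod t.
Proof.
move=> Sf; have [t [tS It gen]] := rideal_generated Sf; exists t => //.
by apply/esym/monic_rgen_rminpoly => //; apply: linprod_monic.
Qed.

Lemma lideal_lminpoly_dvd S f :
  finite_set S -> lideal S f -> exists g, f = lminpoly S * g.
Proof.
move=> Sf; have [t [_ It gen]] := lideal_generated Sf.
by rewrite -(monic_lgen_lminpoly Sf (linprod_monic t) It gen); apply: gen.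
Qed.

Lemma rideal_rminpoly_dvd S f :
  finite_set S -> rideal S f -> exists g, f = g * rminpoly S.
Proof.
move=> Sf; have [t [_ It gen]] := rideal_generated Sf.
by rewrite -(monic_rgen_rminpoly Sf (linprod_monic t) It gen); apply: gen.
Qed.

Lemma lminpoly_lroot S a :
  finite_set S -> leval (lminpoly S) a = 0 -> exists2 b, S b & qsim a b.
Proof.
move=> /lminpoly_linprod[t tS ->] /linprod_lroot[c /tS[b Sb cb] ac].
by exists b => //; apply: qsim_trans cb.
Qed.

Lemma lminpoly_rroot S a :
  finite_set S -> reval (lminpoly S) a = 0 -> exists2 b, S b & qsim a b.
Proof.
move=> /lminpoly_linprod[t tS ->] /linprod_rroot[c /tS[b Sb cb] ac].
by exists b => //; apply: qsim_trans cb.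
Qed.

Lemma rminpoly_rroot S a :
  finite_set S -> reval (rminpoly S) a = 0 -> exists2 b, S b & qsim a b.
Proof.
move=> /rminpoly_linprod[t tS ->] /linprod_rroot[c /tS[b Sb cb] ac].
by exists b => //; apply: qsim_trans cb.
Qed.

(** This is the step at which the twisted node appears: a left multiple of
    [lminpoly (S `\ a)] vanishes at [a] exactly when its cofactor
    vanishes at [ltwist S a]. *)
Lemma lminpolyD1 S a :
  finite_set S -> S a -> leval (lminpoly (S `\ a)) a != 0 ->
  lminpoly S = lminpoly (S `\ a) * ('X - (ltwist S a)%:P).
Proof.
move=> Sf Sa p0; have S1f : finite_set (S `\ a) by apply: finite_setD.
have [Pm IP _] := lminpolyP S1f.
set p := leval _ a in p0.
have twE : p * ltwist S a = a * p by rewrite /ltwist -mulrA mulVKr ?unitqE.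
apply/esym/monic_lgen_lminpoly => //; first by rewrite monicMl // monicXsubC.
  move=> b Sb.
  have [->|/eqP ba] := eqVneq b a; last by apply: levalM_eq0; apply: IP.
  by rewrite (levalM _ twE) levalXsubC subrr mulr0.
move=> f If; have [g fE] : exists g, f = lminpoly (S `\ a) * g.
  by apply: lideal_lminpoly_dvd => // b [Sb _]; apply: If.
have := If _ Sa; rewrite fE => /levalM_root/(_ p0 twE)/lfactor_theorem[h ->].
by exists h; rewrite mulrA.
Qed.

(** Right roots of a left minimal polynomial are not its nodes in general.  In
    a class holding a single node, only the last linear factor can vanish, so
    the only right root there is the root of that factor, the twisted node. *)
Lemma lminpoly_rroot_twist S a d : finite_set S -> S a ->
  ~ (exists2 c, (S `\ a) c & qsim a c) -> qsim d a ->
  reval (lminpoly S) d = 0 -> d = ltwist S a.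
Proof.
move=> Sf Sa alone da; have S1f : finite_set (S `\ a) by apply: finite_setD.
have p0 : leval (lminpoly (S `\ a)) a != 0.
  by apply/eqP => /(lminpoly_lroot S1f).
rewrite (lminpolyD1 Sf Sa p0).
move=> e; apply/eqP; apply: contraT => dtw.
have r0 : reval ('X - (ltwist S a)%:P) d != 0.
  by rewrite /reval hornerXsubC subr_eq0.
have [d' [d'd _ /(lminpoly_rroot S1f)[c Sc d'c]]] := revalM_root e r0.
case: alone; exists c => //; apply: qsim_trans d'c.
by apply: qsim_sym; apply: qsim_trans da.
Qed.

Lemma rtwist_rideal S b : finite_set S -> reval (rminpoly (S `\ b)) b != 0 ->
  rideal S (('X - (rtwist S b)%:P) * rminpoly (S `\ b)).
Proof.
move=> Sf p0 c Sc; have [_ IP _] := rminpolyP (finite_setD [set b] Sf).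
have [->|/eqP cb] := eqVneq c b; last by apply: revalM_eq0; apply: IP.
rewrite (@revalM _ _ _ (rtwist S b)); last by rewrite /rtwist mulrVK ?unitqE.
by rewrite /reval hornerXsubC subrr mul0r.
Qed.

End Evaluation.

(** * Interpolation with two-sided nodes *)

Theorem theorem5p2 (R : realType) (n m k : nat)
    (alpha : 'I_n -> quat R) (beta : 'I_m -> quat R)
    (alpha_inj : injective alpha) (beta_inj : injective beta)
    (beta_nonreal : forall (j : 'I_m) (x : R), beta j <> x%:A)
    (no_three_equiv : forall g : quat R,
       (#|[pred i : 'I_n | alpha i \in qclass g]| +
        #|[pred j : 'I_m | beta j \in qclass g]| <= 2)%N)
    (le_kn : (k <= n)%N) (le_km : (k <= m)%N)
    (alpha_beta_sim : forall i : 'I_k,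
       qsim (alpha (widen_ord le_kn i)) (beta (widen_ord le_km i)))
    (alpha_rest : forall i : 'I_n, (k <= i)%N ->
       qclass (alpha i) `&` range beta = set0)
    (beta_rest : forall j : 'I_m, (k <= j)%N ->
       qclass (beta j) `&` range alpha = set0) :
  let Lambda : set (quat R) := range alpha in
  let Omega : set (quat R) := range beta in
  let a (i : 'I_k) := alpha (widen_ord le_kn i) in
  let b (i : 'I_k) := beta (widen_ord le_km i) in
  let a' (i : 'I_k) := ltwist Lambda (a i) in
  let b' (i : 'I_k) := rtwist Omega (b i) in
  (forall i : 'I_k, [/\ qsim (a' i) (a i), qsim (a i) (b i) & qsim (b i) (b' i)]) /\
  forall f : {poly quat R},
    (lideal Lambda `&` rideal Omega) f <->
    exists (h : {poly quat R}) (mu : 'I_k -> quat R),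
      (forall i : 'I_k, qplane (a' i) (b' i) (mu i)) /\
      f = \sum_(i < k)
            lminpoly Lambda * (mu i)%:P * rminpoly (Omega `\ b i)
          + lminpoly Lambda * h * rminpoly Omega.
Proof.
move=> Lambda Omega a b a' b'.
have Lf : finite_set Lambda by apply: finite_image; apply: finite_finset.
have Of : finite_set Omega by apply: finite_image; apply: finite_finset.
have La i : Lambda (a i) by exists (widen_ord le_kn i).
have L1f i : finite_set (Lambda `\ a i) by apply: finite_setD.
have O1f i : finite_set (Omega `\ b i) by apply: finite_setD.
(* [a i] and [b i] already account for two nodes in their common class. *)
have alone_a i : ~ exists2 c, (Lambda `\ a i) c & qsim (a i) c.
  case=> c [[j _ <-] ji] ac; have := no_three_equiv (a i).
  apply/negP; rewrite -ltnNge.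
  apply: (@leq_add 2 1).
    apply/card_gt1P; exists (widen_ord le_kn i), j; rewrite !inE; split.
    - exact: qsim_refl.
    - exact: qsim_sym.
    - by apply/eqP => ij; apply: ji; rewrite /a ij.
  apply/card_gt0P; exists (widen_ord le_km i).
  by rewrite !inE; apply/qsim_sym/alpha_beta_sim.
have alone_b i : ~ exists2 c, (Omega `\ b i) c & qsim (b i) c.
  case=> c [[j _ <-] ji] bc; have := no_three_equiv (a i).
  apply/negP; rewrite -ltnNge.
  apply: (@leq_add 1 2).
    apply/card_gt0P; exists (widen_ord le_kn i).
    by rewrite !inE; apply: qsim_refl.
  apply/card_gt1P; exists (widen_ord le_km i), j; rewrite !inE; split.
  - exact/qsim_sym/alpha_beta_sim.
  - by apply/qsim_sym; apply: qsim_trans bc; apply: alpha_beta_sim.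
  - by apply/eqP => ij; apply: ji; rewrite /b ij.
have pa i : leval (lminpoly (Lambda `\ a i)) (a i) != 0.
  by apply/eqP => /(lminpoly_lroot (L1f i)); apply: alone_a.
have pb i : reval (rminpoly (Omega `\ b i)) (b i) != 0.
  by apply/eqP => /(rminpoly_rroot (O1f i)); apply: alone_b.
have b'p i : b' i * reval (rminpoly (Omega `\ b i)) (b i) =
             reval (rminpoly (Omega `\ b i)) (b i) * b i.
  by rewrite /b' /rtwist mulrVK ?unitqE.
have sim i : [/\ qsim (a' i) (a i), qsim (a i) (b i) & qsim (b i) (b' i)].
  split; [|exact: alpha_beta_sim|exact: qsim_intertwine (pb i) _].
  by exists (leval (lminpoly (Lambda `\ a i)) (a i)).
split=> // f.
have planeE i c : qplane (a' i) (b' i) c <-> a' i * c = c * b' i.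
  have [aa ab bb] := sim i; apply: qplaneE.
    exact: qsim_trans aa (qsim_trans ab bb).
  move=> x b'x; apply: (@beta_nonreal (widen_ord le_km i) x).
  case: bb => h h0; rewrite -/(b i) b'x -mulrA => ->.
  by rewrite mulr_algl -scalerAr mulVr ?unitqE.
have [_ ILP _] := lminpolyP Lf; have [_ IRP _] := rminpolyP Of.
split; last first.
  case=> h [mu [muP ->]]; split.
    have -> : \sum_(i < k) lminpoly Lambda * (mu i)%:P * rminpoly (Omega `\ b i)
            + lminpoly Lambda * h * rminpoly Omega
      = lminpoly Lambda * (\sum_(i < k) (mu i)%:P * rminpoly (Omega `\ b i)
            + h * rminpoly Omega).
      by rewrite mulrDr mulr_sumr mulrA; under eq_bigr do rewrite -mulrA.
    by move=> c Lc; apply: levalM_eq0; apply: ILP.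
  move=> c Oc; rewrite /reval hornerD horner_sum big1 ?add0r; last first.
    move=> i _.
    (* The plane condition lets the last factor of [lminpoly Lambda] cross
       [mu i], where it turns into the factor missing on the right. *)
    rewrite (lminpolyD1 Lf (La i) (pa i)).
    have -> : lminpoly (Lambda `\ a i) * ('X - (a' i)%:P) * (mu i)%:P
        = lminpoly (Lambda `\ a i) * (mu i)%:P * ('X - (b' i)%:P).
      rewrite -!mulrA; congr (_ * _).
      rewrite mulrBl mulrBr -commr_polyX -!polyCM.
      by congr (_ - _%:P); apply/planeE.
    by rewrite -mulrA; apply: revalM_eq0; apply: rtwist_rideal.
  by apply: revalM_eq0; apply: IRP.
case=> ILf IRf; have [g fE] := lideal_lminpoly_dvd Lf ILf.
have rootf j : reval (lminpoly Lambda * g) (beta j) = 0.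
  by rewrite -fE; apply: IRf; exists j.
have twg i : a' i * reval g (b i) = reval g (b i) * b i.
  have [->|q0] := eqVneq (reval g (b i)) 0; first by rewrite mulr0 mul0r.
  have [d [db dq Pd]] := revalM_root (rootf _) q0.
  suff -> : a' i = d by [].
  apply/esym/lminpoly_rroot_twist => //.
  by apply: (qsim_trans db); apply/qsim_sym/alpha_beta_sim.
(* Subtracting the interpolant of [g] at the first [k] nodes of [Omega] leaves
   a polynomial vanishing at these nodes; at the others [g] vanishes already. *)
pose mu i := reval g (b i) / reval (rminpoly (Omega `\ b i)) (b i).
have Ig : rideal Omega (g - \sum_(i < k) (mu i)%:P * rminpoly (Omega `\ b i)).
  move=> _ [j _ <-]; rewrite /reval hornerD hornerN horner_sum.
  have off (i : 'I_k) : beta j != b i ->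
      ((mu i)%:P * rminpoly (Omega `\ b i)).[beta j] = 0.
    move=> /eqP ji; have [_ IP _] := rminpolyP (O1f i).
    by apply: revalM_eq0; apply: IP; split=> //; exists j.
  case: (ltnP j k) => jk.
    have jE : beta j = b (Ordinal jk) by congr beta; apply: val_inj.
    rewrite (bigD1 (Ordinal jk)) //= big1 ?addr0.
      by rewrite jE hornerCM /mu mulrVK ?unitqE // subrr.
    move=> i ij; apply: off.
    apply: contraNneq ij => /beta_inj/(congr1 val) /= e.
    by apply/eqP/val_inj.
  rewrite big1 ?subr0.
    apply/eqP; apply: contraT => /(revalM_root (rootf j))[d [dj _]].
    move=> /(lminpoly_rroot Lf)[c Lc dc].
    have : set0 c; last by [].
    rewrite -(beta_rest _ jk); split=> //.
    exact: qsim_trans (qsim_sym dc) dj.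
  move=> i _; apply: off; apply/eqP => /beta_inj/(congr1 val) /= ji.
  by have := ltn_ord i; rewrite -ji ltnNge jk.
have [h hE] := rideal_rminpoly_dvd Of Ig.
exists h, mu; split=> [i|].
  apply/planeE; rewrite /mu mulrA twg -!mulrA; congr (_ * _).
  apply: (mulIr (x := reval (rminpoly (Omega `\ b i)) (b i))).
    by rewrite unitqE.
  by rewrite mulrVK ?unitqE // -mulrA b'p mulKr ?unitqE.
rewrite fE -mulrA -hE mulrBr; under eq_bigr do rewrite -mulrA.
by rewrite -mulr_sumr addrC subrK.
Qed.
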